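(* Let $E$ be a locally convex space. Then: (i) if $p\in[1,\infty]$ and $S_p\big(\mathcal{L}(E,\ell_p)\big)\subseteq\ell_p^w(E'_\beta)$ (for $p=\infty$: $S_\infty\big(\mathcal{L}(E,c_0)\big)\subseteq c_0^w(E'_\beta)$), then every $(p,p)$-$(V^\ast)$ subset of $E$ is a coarse $p$-limited set; (ii) if $1<p<\infty$, then every $(p,p)$-$(V^\ast)$ subset $A$ of $E$ is a coarse $p$-limited set; (iii) if $p=\infty$ and $S_\infty\big(\mathcal{L}(E,c_0)\big)=c_0^w(E'_\beta)$, then the class of $\infty$-$(V^\ast)$ subsets of $E$ coincides with the class of coarse $\infty$-limited subsets of $E$; (iv) if $p\in[1,\infty]$, then every $p$-limited subset of $E$ is coarse $p$-limited; in particular, every finite subset of $E$ is coarse $p$-limited.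
   Context: All locally convex spaces are Hausdorff, over $\mathbb{F}\in\{\mathbb{R},\mathbb{C}\}$; $\omega=\{0,1,2,\dots\}$; subsets are non-empty. $E'$ is the topological dual of $E$; $E'_{w^\ast}=(E',\sigma(E',E))$; $E'_\beta=(E',\beta(E',E))$ is the strong dual. $\mathcal{L}(E,L)$ is the set of continuous linear maps from $E$ to $L$. A sequence $\{x_n\}_{n\in\omega}$ in an lcs $F$ is weakly $p$-summable if $(\langle\chi,x_n\rangle)_n\in\ell_p$ (or $\in c_0$ if $p=\infty$) for every $\chi\in F'$; $\ell_p^w(F)$ (or $c_0^w(F)$ if $p=\infty$) is the vector space of all such sequences. A sequence in $E'$ is weak$^\ast$ $p$-summable if it is weakly $p$-summable in $E'_{w^\ast}$. The map $S_p:\mathcal{L}(E,\ell_p)\to\ell_p^w(E'_{w^\ast})$ (or $S_\infty:\mathcal{L}(E,c_0)\to c_0^w(E'_{w^\ast})$ if $p=\infty$) is defined by $S_p(T):=(T^\ast(e_n^\ast))_{n\in\omega}$, where $e_n^\ast$ is the $n$-th coordinate functional on $\ell_p$ (or $c_0$) and $T^\ast(e_n^\ast)=e_n^\ast\circ T$. A subset $A$ of $E$ is coarse $p$-limited if $T(A)$ is relatively compact for every $T\in\mathcal{L}(E,\ell_p)$ (or $T\in\mathcal{L}(E,c_0)$ if $p=\infty$). $A$ is a $(p,q)$-$(V^\ast)$ set if $\big(\sup_{a\in A}|\langle\chi_n,a\rangle|\big)_n\in\ell_q$ (or $\in c_0$ if $q=\infty$) for every weakly $p$-summable sequence $\{\chi_n\}$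 in $E'_\beta$; $\infty$-$(V^\ast)$ means $(\infty,\infty)$-$(V^\ast)$. $A$ is $p$-limited if $\big(\sup_{a\in A}|\langle\chi_n,a\rangle|\big)_n\in\ell_p$ (or $\in c_0$ if $p=\infty$) for every weak$^\ast$ $p$-summable sequence $\{\chi_n\}$ in $E'$. *)

(* Defs.v *)
From HB Require Import structures.
From mathcomp Require Import all_boot all_order all_algebra.
From mathcomp Require Import finmap.
From mathcomp Require Import all_classical all_reals all_analysis.
From mathcomp Require Import ess_sup_inf complex.

Set Implicit Arguments.
Unset Strict Implicit.
Unset Printing Implicit Defensive.

Import Order.TTheory GRing.Theory Num.Theory.
Import numFieldTopology.Exports.

Local Open Scope classical_set_scope.
Local Open Scope ring_scope.

Variant scalars := RealScalars | ComplexScalars.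

Definition scalar_field (R : realType) (s : scalars) : numFieldType :=
  if s is ComplexScalars then (R[i] : numFieldType) else (R : numFieldType).

(* The norm `|x| of a numFieldType takes values in the field itself;
   modulus x is the same number seen as an element of R. *)
Definition modulus (R : realType) (s : scalars) : scalar_field R s -> R :=
  match s return scalar_field R s -> R with
  | RealScalars => fun x : R => `|x|
  | ComplexScalars => fun z : R[i] => complex.Re `|z|
  end.

Definition of_real (R : realType) (s : scalars) : R -> scalar_field R s :=
  match s return R -> scalar_field R s with
  | RealScalars => id
  | ComplexScalars => fun x : R => (x%:C)%C
  end.
Arguments of_real {R} s.

Section modulus.
Context {R : realType} {s : scalars}.
Implicit Types x y : scalar_field R s.

Lemma of_real_modulus x : of_real s (modulus x) = `|x|.
Proof. by case: s x => //= x; rewrite RRe_real// normr_real. Qed.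

Lemma of_realD (a b : R) : of_real s (a + b) = of_real s a + of_real s b.
Proof. by case: s => //=; rewrite rmorphD. Qed.

Lemma of_realM (a b : R) : of_real s (a * b) = of_real s a * of_real s b.
Proof. by case: s => //=; rewrite rmorphM. Qed.

Lemma ler_of_real (a b : R) : (of_real s a <= of_real s b) = (a <= b).
Proof. by case: s => //=; rewrite lecR. Qed.

Lemma of_real_inj : injective (of_real s : R -> _).
Proof. by case: s => [|a b] //= -[]. Qed.

Lemma of_real0 : of_real s (0 : R) = 0.
Proof. by apply: (addrI (of_real s 0)); rewrite -of_realD !addr0. Qed.

Lemma modulus0 : modulus (0 : scalar_field R s) = 0.
Proof. by apply: of_real_inj; rewrite of_real_modulus normr0 of_real0. Qed.

Lemma modulus_ge0 x : 0 <= modulus x.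
Proof. by rewrite -ler_of_real of_real_modulus of_real0. Qed.

Lemma modulus_eq0 x : modulus x = 0 -> x = 0.
Proof.
by move=> x0; apply/eqP; rewrite -normr_eq0 -of_real_modulus x0 of_real0.
Qed.

Lemma modulusM x y : modulus (x * y) = modulus x * modulus y.
Proof. by apply: of_real_inj; rewrite of_realM !of_real_modulus normrM. Qed.

Lemma ler_modulusD x y : modulus (x + y) <= modulus x + modulus y.
Proof. by rewrite -ler_of_real of_realD !of_real_modulus ler_normD. Qed.

End modulus.

(* Membership of a sequence in l_p when 1 <= p < +oo, and in c_0 when p = +oo. *)
Definition ell_mem (R : realType) (p : \bar R) (u : nat -> R) : Prop :=
  if p == +oo%E then u @ \oo --> 0 else finite_norm counting p u.

Section ell_mem.
Context {R : realType} (p : \bar R) (p1 : (1 <= p)%E).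
Implicit Types u v : nat -> R.
Local Notation N u := (Lnorm (@counting nat R) p (EFin \o u%R)).

Let measurable_seq u : measurable_fun setT u.
Proof. by []. Qed.

Lemma le_Lnorm_counting u v : (forall n, `|u n| <= `|v n|) -> (N u <= N v)%E.
Proof.
move=> uv; case: p p1 => [r r1||//]; last first.
  move=> _; rewrite unlock; case: ifPn => // _; apply: le_ess_sup.
  by apply: nearW => n /=; rewrite lee_fin.
have r0 : 0 < r by rewrite (lt_le_trans ltr01).
rewrite !Lnorm_counting//; apply: gt0_ler_poweR => //.
- by rewrite invr_ge0 ltW.
- by rewrite in_itv/= leey andbT nneseries_ge0// => *; exact: poweR_ge0.
- by rewrite in_itv/= leey andbT nneseries_ge0// => *; exact: poweR_ge0.
apply: lee_nneseries => n _; first by rewrite poweR_ge0.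
by rewrite /= lee_fin ge0_ler_powR// ?ltW// nnegrE.
Qed.

Lemma counting_ae (P : nat -> Prop) n :
  (\forall k \ae (@counting nat R), P k) -> P n.
Proof.
move=> [A [mA A0 PA]]; apply: contrapT => Pn.
have An : [set n] `<=` A by move=> _ ->; exact: PA.
suff : (@counting nat R [set n] <= 0)%E.
  by rewrite /counting asboolT// fset_set1 cardfs1 lee_fin ler10.
by rewrite -A0; apply: (@le_measure _ _ _ (@counting nat R)); rewrite ?inE.
Qed.

Lemma le_Lnorm_coord u n : (`|u n|%:E <= N u)%E.
Proof.
case: p p1 => [r r1||//]; last first.
  move=> _; rewrite unlock /Lnorm ifT; last first.
    suff cT : counting [set: nat] = +oo%E :> \bar R by rewrite [ltRHS]cT ltry.
    by rewrite /counting asboolF//; exact: infinite_nat.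
  have := counting_ae n (ess_sup_ge counting (abse \o (EFin \o u))).
  by [].
have r0 : 0 < r by rewrite (lt_le_trans ltr01).
rewrite Lnorm_counting//.
have -> : (`|u n|%:E = (`|u n|%:E `^ r) `^ r^-1)%E.
  by rewrite -poweRrM mulfV ?gt_eqF// poweRe1.
apply: gt0_ler_poweR => //.
- by rewrite invr_ge0 ltW.
- by rewrite in_itv/= lee_fin powR_ge0 leey.
- by rewrite in_itv/= leey andbT nneseries_ge0// => *; exact: poweR_ge0.
rewrite (@nneseriesD1 _ _ n)//= ?leeDl//.
  by apply: nneseries_ge0 => k _ _; rewrite lee_fin powR_ge0.
Qed.

Lemma ell_mem_finite_norm u : ell_mem p u -> finite_norm counting p u.
Proof.
rewrite /ell_mem; case: eqP => [->|//] u0.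
have /cvg_seq_bounded[M [_ uM]] : cvgn u by apply/cvg_ex; exists 0.
rewrite /finite_norm unlock; case: ifPn => // _.
apply: (@le_lt_trans _ _ (M + 1)%:E); last exact: ltry.
apply/ess_supP; apply: nearW => n /=; rewrite lee_fin.
by apply: uM => //; rewrite ltrDl.
Qed.

Lemma ell_mem_fineK u : ell_mem p u -> ((fine (N u))%:E = N u)%E.
Proof.
move=> /ell_mem_finite_norm uoo.
by rewrite fineK// ge0_fin_numE//; exact: Lnorm_ge0.
Qed.

Lemma ell_mem0 : ell_mem p (fun=> 0 : R).
Proof.
rewrite /ell_mem; case: eqP => [_|_]; first exact: cvg_cst.
by rewrite /finite_norm (@Lnorm0 _ _ _ counting) // gt_eqF// (lt_le_trans _ p1).
Qed.

Lemma LnormD_counting u v : (N (u \+ v) <= N u + N v)%E.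
Proof. exact: (eminkowski (@counting nat R)). Qed.

Lemma LnormZ_counting u (a : R) : 0 <= a -> ell_mem p u ->
  (N (fun n => a * u n) = a%:E * N u)%E.
Proof.
move=> a0 /ell_mem_finite_norm /mem_set uf.
have uL : u \in Lfun counting p by rewrite inE; apply/andP; split => //; rewrite inE.
rewrite -[in LHS](ger0_norm a0).
have := LnormZ (Lfun_Sub p1 uL) a.
by rewrite (ger0_norm a0).
Qed.

Lemma ell_memD u v : ell_mem p u -> ell_mem p v -> ell_mem p (u \+ v).
Proof.
rewrite /ell_mem; case: ifPn => [_ u0 v0|_ uoo voo].
  by rewrite -(addr0 0); exact: cvgD.
exact: le_lt_trans (LnormD_counting _ _) (lte_add_pinfty _ _).
Qed.

Lemma ell_memZ (a : R) u : 0 <= a -> ell_mem p u -> ell_mem p (fun n => a * u n).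
Proof.
move=> a0 pu; have := LnormZ_counting a0 pu; have := ell_mem_finite_norm pu.
move: pu; rewrite /ell_mem; case: ifPn => [_ u0 _ _|_ _ uoo E].
  by rewrite -(mulr0 a); apply: cvgM => //; exact: cvg_cst.
by rewrite /finite_norm E lte_mul_pinfty// lee_fin.
Qed.

Lemma le_ell_mem u v : (forall n, `|u n| <= `|v n|) -> ell_mem p v -> ell_mem p u.
Proof.
move=> uv; rewrite /ell_mem; case: ifPn => [_ v0|_].
  apply/cvgr0Pnorm_le => e e0; near=> n; apply: le_trans (uv n) _.
  by near: n; move/cvgr0Pnorm_le : v0; exact.
by apply: le_lt_trans; exact: le_Lnorm_counting.
Unshelve. all: by end_near. Qed.

End ell_mem.

Section ell.
Context {R : realType} (s : scalars) (p : \bar R).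
Local Notation K := (scalar_field R s).

Definition ell_pred of (1 <= p)%E : {pred nat -> K^o} :=
  fun x => `[< ell_mem p (fun n => modulus (x n)) >].

(* The Banach space l_p over K if p < +oo, and c_0 if p = +oo. The argument p1
   is there for the normedModType instance below: it gives the triangle
   inequality. *)
Record ell (p1 : (1 <= p)%E) := Ell {
  ell_seq :> nat -> K^o ;
  ell_seqP : ell_seq \in ell_pred p1 }.

End ell.

Section ell_normedModType.
Context {R : realType} (s : scalars) (p : \bar R) (p1 : (1 <= p)%E).
Local Notation K := (scalar_field R s).
Local Notation ell := (ell s p1).
Local Notation ell_pred := (@ell_pred R s p p1).

HB.instance Definition _ := [isSub for @ell_seq R s p p1].
HB.instance Definition _ := [Choice of ell by <:].

Lemma ell_predP (x : nat -> K^o) :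
  reflect (ell_mem p (fun n => modulus (x n))) (x \in ell_pred).
Proof. exact: asboolP. Qed.

Lemma ell_submod_closed : submod_closed ell_pred.
Proof.
split.
  by apply/ell_predP; under eq_fun do rewrite modulus0; exact: ell_mem0.
move=> a x y /ell_predP px /ell_predP py; apply/ell_predP.
have := ell_memD p1 (ell_memZ p1 (modulus_ge0 a) px) py.
apply: (le_ell_mem p1) => n.
rewrite ger0_norm ?modulus_ge0// ger0_norm ?addr_ge0 ?mulr_ge0 ?modulus_ge0//.
by apply: le_trans (ler_modulusD _ _) _; rewrite modulusM.
Qed.

HB.instance Definition _ := GRing.isSubmodClosed.Build _ _ ell_pred
  ell_submod_closed.
HB.instance Definition _ := [SubChoice_isSubLmodule of ell by <:].

(* Lnorm counting p is the l_p-norm of a sequence, and the supremum norm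
   when p = +oo. *)
Definition ell_norm (x : ell) : K :=
  of_real s (fine (Lnorm counting p (fun n => (modulus (x n))%:E))).

Lemma ell_memP (x : ell) : ell_mem p (fun n => modulus (x n)).
Proof. exact/ell_predP/ell_seqP. Qed.

Lemma ell_normE (x : ell) :
  ((fine (Lnorm counting p (fun n => (modulus (x n))%:E)))%:E =
   Lnorm counting p (fun n => (modulus (x n))%:E))%E.
Proof. exact: (ell_mem_fineK (ell_memP x)). Qed.

Lemma le_ell_norm (x : ell) n : `|x n : K| <= ell_norm x.
Proof.
rewrite -of_real_modulus ler_of_real -lee_fin ell_normE.
have := le_Lnorm_coord p1 (fun n => modulus (x n)) n.
by rewrite ger0_norm ?modulus_ge0.
Qed.

Let ell_normD (x y : ell) : ell_norm (x + y) <= ell_norm x + ell_norm y.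
Proof.
rewrite -of_realD ler_of_real -lee_fin EFinD !ell_normE.
apply: le_trans (LnormD_counting p1 _ _); apply: (le_Lnorm_counting p1) => n.
rewrite ger0_norm ?modulus_ge0// ger0_norm ?addr_ge0 ?modulus_ge0//.
exact: ler_modulusD.
Qed.

Let ell_normZ (a : K) (x : ell) : ell_norm (a *: x) = `|a| * ell_norm x.
Proof.
rewrite -of_real_modulus -of_realM; congr of_real; apply/EFin_inj.
rewrite EFinM !ell_normE -(LnormZ_counting p1 (modulus_ge0 a) (ell_memP x)).
by congr Lnorm; apply/funext => n /=; rewrite modulusM.
Qed.

Let ell_norm_eq0 (x : ell) : ell_norm x = 0 -> x = 0.
Proof.
move=> x0; apply/val_inj/funext => n; apply/eqP.
by rewrite -normr_le0 -[X in _ <= X]x0 le_ell_norm.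
Qed.

HB.instance Definition _ := Lmodule_isNormed.Build K ell
  ell_normD ell_normZ ell_norm_eq0.

End ell_normedModType.

Section continuous_linear.
Context {K : numFieldType}.

Definition clin_pred (E : preTopologicalLmodType K) (F : topologicalLmodType K) :
    {pred E -> F} :=
  fun f => `[< linear f /\ continuous f >].

Record clin (E : preTopologicalLmodType K) (F : topologicalLmodType K) := Clin {
  clin_fun :> E -> F ;
  clin_funP : clin_fun \in @clin_pred E F }.

Context {E : preTopologicalLmodType K} {F : topologicalLmodType K}.
Local Notation pred_EF := (@clin_pred E F).

HB.instance Definition _ := [isSub for @clin_fun E F].
HB.instance Definition _ := [Choice of clin E F by <:].

Lemma clin_predP (f : E -> F) :
  reflect (linear f /\ continuous f) (f \in pred_EF).
Proof. exact: asboolP. Qed.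

Lemma clin_linear (f : clin E F) : linear f.
Proof. by have /clin_predP[] := clin_funP f. Qed.

Lemma clin_continuous (f : clin E F) : continuous f.
Proof. by have /clin_predP[] := clin_funP f. Qed.

HB.instance Definition _ (f : clin E F) :=
  GRing.isLinear.Build K E F _ (clin_fun f) (clin_linear f).

Lemma clin_submod_closed : submod_closed pred_EF.
Proof.
split.
  apply/clin_predP; split; last exact: cst_continuous.
  by move=> a x y; rewrite scaler0 addr0.
move=> a f g /clin_predP[fl fc] /clin_predP[gl gc]; apply/clin_predP; split.
  have fgE z : (a *: f + g) z = a *: f z + g z by [].
  move=> b x y; rewrite !fgE fl gl !scalerDr !scalerA.
  by rewrite addrACA (mulrC a b).
move=> x; apply: (@continuous_comp _ _ _ (fun x => (a *: f x, g x))
  (fun z : F * F => z.1 + z.2)); last exact: add_continuous.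
apply: cvg_pair => /=; last exact: gc.
apply: (@continuous_comp _ _ _ (fun x => (a : K^o, f x))
  (fun z : K^o * F => z.1 *: z.2)); last exact: scale_continuous.
by apply: (@cvg_pair _ _ _ _ (nbhs (a : K^o))); [exact: cvg_cst|exact: fc].
Qed.

HB.instance Definition _ := GRing.isSubmodClosed.Build _ _ pred_EF
  clin_submod_closed.
HB.instance Definition _ := [SubChoice_isSubLmodule of clin E F by <:].

End continuous_linear.

Definition dual (K : numFieldType) (E : preTopologicalLmodType K) : Type :=
  clin E K^o.

HB.instance Definition _ (K : numFieldType) (E : preTopologicalLmodType K) :=
  GRing.Lmodule.copy (dual E) (clin E K^o).

Definition tvs_bounded (K : numFieldType) (E : preTopologicalLmodType K) :
    set (set E) :=
  [set A | forall U : set E, nbhs 0 U -> exists t : K, 0 < t /\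
    forall r : K, t < r -> A `<=` [set r *: u | u in U]].
Arguments tvs_bounded {K} E.

Definition weak_star_dual (K : numFieldType) (E : preTopologicalLmodType K) :
  Type := dual E.

HB.instance Definition _ (K : numFieldType) (E : preTopologicalLmodType K) :=
  GRing.Lmodule.copy (weak_star_dual E) (dual E).
HB.instance Definition _ (K : numFieldType) (E : preTopologicalLmodType K) :=
  Topological.copy (weak_star_dual E)
    (initial_topology (fun chi : dual E => (clin_fun chi : {ptws E -> K^o}))).

(* beta(E', E) is uniform convergence on the bounded subsets of E; by Mackey's
   theorem these are the weakly bounded ones when E is locally convex. *)
Definition strong_dual (K : numFieldType) (E : preTopologicalLmodType K) :
  Type := dual E.

HB.instance Definition _ (K : numFieldType) (E : preTopologicalLmodType K) :=
  GRing.Lmodule.copy (strong_dual E) (dual E).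
HB.instance Definition _ (K : numFieldType) (E : preTopologicalLmodType K) :=
  Topological.copy (strong_dual E)
    (initial_topology (fun chi : dual E =>
      (clin_fun chi : {family tvs_bounded E, E -> K^o}))).

Section adjoint.
Context {K : numFieldType} {E : preTopologicalLmodType K}.
Context {F : topologicalLmodType K} (T : clin E F).

Lemma adjoint_subproof (chi : dual F) : chi \o T \in @clin_pred K E K^o.
Proof.
apply/clin_predP; split; first by move=> a x y /=; rewrite !linearP.
move=> x; apply: continuous_comp; [exact: clin_continuous|].
exact: (@clin_continuous _ _ _ chi).
Qed.

Definition adjoint (chi : dual F) : dual E := Clin (adjoint_subproof chi).

End adjoint.

Section coordinate.
Context {R : realType} {s : scalars} {p : \bar R} (p1 : (1 <= p)%E).
Local Notation K := (scalar_field R s).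

Lemma ell_coord_subproof n :
  (fun x : ell s p1 => x n) \in @clin_pred K (ell s p1) K^o.
Proof.
apply/clin_predP; split => // x.
have Fx : Filter (nbhs (x : ell s p1)) by exact: nbhs_filter.
apply/(@cvgrPdist_lt _ K^o _ (nbhs (x : ell s p1)) Fx) => e e0; near=> y.
apply: (@le_lt_trans _ _ `|x - y|); first exact: (le_ell_norm (x - y) n).
by near: y; exact: cvgr_dist_lt.
Unshelve. all: by end_near. Qed.

Definition ell_coord n : dual (ell s p1) := Clin (ell_coord_subproof n).

Definition Sp (E : preTopologicalLmodType K) (T : clin E (ell s p1)) :
  nat -> dual E := fun n => adjoint T (ell_coord n).

End coordinate.

Section limited.
Context {R : realType} {s : scalars}.
Local Notation K := (scalar_field R s).

Definition weakly_summable (p : \bar R) (F : preTopologicalLmodType K) :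
    set (nat -> F) :=
  [set x | forall chi : dual F,
    ell_mem p (fun n => modulus (clin_fun chi (x n) : K))].

Arguments weakly_summable : clear implicits.

Context (E : preTopologicalLmodType K).

(* The suprema have to be finite: sup X = 0 for an unbounded X. *)
Definition sup_ell_mem (p : \bar R) (A : set E) (chi : nat -> dual E) : Prop :=
  let X n := [set modulus (clin_fun (chi n) a : K) | a in A] in
  (forall n, has_ubound (X n)) /\ ell_mem p (fun n => sup (X n)).

Definition coarse_limited (p : \bar R) (p1 : (1 <= p)%E) : set (set E) :=
  [set A | A !=set0 /\
    forall T : clin E (ell s p1), precompact [set T a | a in A]].

Definition Vstar (p q : \bar R) : set (set E) :=
  [set A | A !=set0 /\
    forall chi : nat -> strong_dual E,
      weakly_summable p (strong_dual E) chi -> sup_ell_mem q A chi].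

Definition limited (p : \bar R) : set (set E) :=
  [set A | A !=set0 /\
    forall chi : nat -> weak_star_dual E,
      weakly_summable p (weak_star_dual E) chi -> sup_ell_mem p A chi].

End limited.

Arguments weakly_summable {R s} p F.
Arguments coarse_limited {R s} E {p} p1.
Arguments Vstar {R s} E p q.
Arguments limited {R s} E p.

(* Main.v *)
Require Import Defs.
From HB Require Import structures.
From mathcomp Require Import all_boot all_order all_algebra.
From mathcomp Require Import all_classical all_reals all_analysis.
From mathcomp Require Import ess_sup_inf complex lra.
Set Implicit Arguments.
Unset Strict Implicit.
Unset Printing Implicit Defensive.
Import Order.TTheory GRing.Theory Num.Theory.
Import numFieldNormedType.Exports.
Local Open Scope classical_set_scope.
Local Open Scope ring_scope.

(** Everything rests on one compactness fact. If b lies in l_p (in c_0 when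
    p = +oo), then the box of all sequences x with |x n| <= b n is compact in
    l_p (c_0): along an ultrafilter the coordinates converge, and since b has
    small tails, coordinatewise convergence inside the box is convergence in
    norm ([ell_box_compact]). For a continuous linear T : E -> l_p, the supremum
    over A of the n-th functional of Sp T is exactly the size of the n-th
    coordinate on T(A). So if these suprema form an l_p sequence, T(A) lies in a
    compact box ([sup_ell_mem_precompact]), and A is coarse p-limited as soon as
    each Sp T is one of the sequences against which A is tested. This is the
    hypothesis in (i); in (ii) and (iv) it has to be proved.

    In (iv), a weak* continuous functional chi on the dual satisfies
    |chi f| <= C max_B |f| for a finite set B, so |chi (Sp T n)| is at most
    C times the sum of |T x n| over x in B, an l_p sequence
    ([Sp_weak_star_summable]). In (ii), a strongly continuous functional chi
    satisfies |chi f| <= C sup_B |f| for a bounded set B, and T(B) is bounded in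
    l_p, by M say. Testing chi on the combinations of the Sp T k with
    coefficients of modulus |chi (Sp T k)|^(p-1) and with the phase that makes
    every term nonnegative bounds the partial sums of |chi (Sp T k)|^p by a
    constant depending on C, M and p only: this is the duality between l_p and
    its conjugate space, made explicit ([Sp_strong_summable]).

    For the converse inclusion in (iii), every chi is Sp T for some T, and a
    relatively compact subset of c_0 has uniformly small tails
    ([precompact_sup_ell_mem]). *)

(** * Scalars and their moduli *)

Section scalars.
Context {R : realType} {s : scalars}.
Local Notation K := (scalar_field R s).

Lemma of_real_modulusK (e : K) : 0 < e -> of_real s (modulus e) = e.
Proof. by move=> e0; rewrite of_real_modulus gtr0_norm. Qed.

Lemma of_real_ge0 (r : R) : (0 <= of_real s r) = (0 <= r).
Proof. by rewrite -(@ler_of_real R s) of_real0. Qed.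

Lemma of_real_gt0 (r : R) : (0 < of_real s r) = (0 < r).
Proof.
rewrite !lt_def of_real_ge0; congr (~~ _ && _).
by rewrite -(inj_eq (@of_real_inj R s)) of_real0.
Qed.

Lemma ltr_of_real (a b : R) : (of_real s a < of_real s b) = (a < b).
Proof. by rewrite !lt_neqAle ler_of_real (inj_eq (@of_real_inj R s)). Qed.

Lemma modulus_gt0 (e : K) : 0 < e -> 0 < modulus e.
Proof. by move=> e0; rewrite -of_real_gt0 of_real_modulusK. Qed.

Lemma modulus_of_real (r : R) : 0 <= r -> modulus (of_real s r) = r.
Proof.
move=> r0; apply: (@of_real_inj R s).
by rewrite of_real_modulus ger0_norm// of_real_ge0.
Qed.

Lemma modulusN (x : K) : modulus (- x) = modulus x.
Proof. by apply: (@of_real_inj R s); rewrite !of_real_modulus normrN. Qed.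

Lemma modulus_distC (x y : K) : modulus (x - y) = modulus (y - x).
Proof. by rewrite -modulusN opprB. Qed.

Lemma ler_modulus_sum (n : nat) (f : nat -> K) :
  modulus (\sum_(k < n) f k) <= \sum_(k < n) modulus (f k).
Proof.
elim: n => [|n ih]; first by rewrite !big_ord0 modulus0.
by rewrite !big_ord_recr/= (le_trans (ler_modulusD _ _))// lerD2r.
Qed.

Lemma of_real_sum (n : nat) (f : nat -> R) :
  of_real s (\sum_(k < n) f k) = \sum_(k < n) of_real s (f k).
Proof.
elim: n => [|n ih]; first by rewrite !big_ord0 of_real0.
by rewrite !big_ord_recr/= of_realD ih.
Qed.

Lemma ex_phase (y : K) : exists u : K, modulus u = 1 /\ u * y = of_real s (modulus y).
Proof.
have [->|y0] := eqVneq y 0.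
  exists (of_real s 1); rewrite modulus_of_real// mulr0 modulus0 of_real0.
  by [].
exists (`|y| / y); rewrite of_real_modulus mulfVK//; split => //.
apply: (@of_real_inj R s).
have -> : of_real s (1 : R) = 1.
  by case: (s).
by rewrite of_real_modulus normrM normfV normr_id divff// normr_eq0.
Qed.

(** Convergence of scalars, with real radii: the norm of a numFieldType is
    valued in the field itself, which is awkward over the complex numbers. *)
Lemma near_modulus {T : Type} (F : set_system T) {FF : Filter F} (f : T -> K) (l : K) :
  f @ F --> (l : K^o) <-> (forall r : R, 0 < r -> \near F, modulus (f F - l) <= r).
Proof.
split.
  move=> /cvgrPdist_le fl r r0.
  have : 0 < of_real s r by rewrite of_real_gt0.
  move=> /fl; apply: filterS => x.
  by rewrite -of_real_modulus ler_of_real modulus_distC.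
move=> fl; apply/(@cvgrPdist_le _ K^o) => e e0.
apply: filterS (fl (modulus e) (modulus_gt0 e0)) => x.
by rewrite -(@ler_of_real R s) (of_real_modulusK e0) of_real_modulus distrC.
Qed.

End scalars.

(** A compact superset of the disc is all that the compactness of boxes needs,
    and over the complex numbers the square [-r, r] + i [-r, r] is at hand as a
    continuous image of a compact product. *)
Lemma modulus_disc_sub_compact {R : realType} {s : scalars} (r : R) :
  exists2 C : set (scalar_field R s)^o, compact C &
    [set x | modulus (x : scalar_field R s) <= r] `<=` C.
Proof.
case: s => /=.
  exists (`[- r, r]%classic : set R^o); first exact: segment_compact.
  by move=> x /=; rewrite in_itv/= ler_norml.
pose Q := `[- r, r]%classic `*` `[- r, r]%classic : set (R * R).
pose h (z : R * R) : R[i]^o := (z.1 +i* z.2)%C.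
have hc : continuous h.
  move=> z; apply/cvgrPdist_le => e e0.
  have eR : e = ((complex.Re e)%:C)%C.
    by rewrite RRe_real// ger0_real// ltW.
  have er0 : 0 < complex.Re e by move: e0; rewrite eR ltcR.
  have e2 : 0 < complex.Re e / 2 by rewrite divr_gt0.
  have c1 : \forall z' \near z, `|z.1 - z'.1| <= complex.Re e / 2.
    have /cvgrPdist_le : (fun z' : R * R => z'.1) @ z --> z.1 by exact: cvg_fst.
    exact.
  have c2 : \forall z' \near z, `|z.2 - z'.2| <= complex.Re e / 2.
    have /cvgrPdist_le : (fun z' : R * R => z'.2) @ z --> z.2 by exact: cvg_snd.
    exact.
  apply: filterS2 c1 c2 => -[a b]/= h1 h2.
  rewrite eR /h /= .
  have -> : ((z.1 +i* z.2) - (a +i* b))%C = ((z.1 - a)%:C + 'i%C * (z.2 - b)%:C)%C.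
    by simpc.
  apply: (le_trans (ler_normD _ _)).
  have -> : `|'i%C * (z.2 - b)%:C%C| = `|(z.2 - b)%:C%C| :> R[i].
    rewrite normrM; have -> : `|'i%C| = 1 :> R[i].
      by rewrite normc_def/= expr0n/= expr1n add0r sqrtr1.
    by rewrite mul1r.
  rewrite !normc_def/= !expr0n/= !addr0 !sqrtr_sqr -rmorphD/= lecR.
  lra.
exists (h @` Q).
  apply: continuous_compact; last by apply: compact_setX; exact: segment_compact.
  exact: continuous_subspaceT.
move=> [a b] /= abr; exists (a, b) => //; rewrite /Q /= !in_itv/= -!ler_norml.
have na : `|a| <= Num.sqrt (a ^+ 2 + b ^+ 2).
  by rewrite -sqrtr_sqr ler_wsqrtr// lerDl sqr_ge0.
have nb : `|b| <= Num.sqrt (a ^+ 2 + b ^+ 2).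
  by rewrite -sqrtr_sqr ler_wsqrtr// lerDr sqr_ge0.
by split; [exact: le_trans na abr|exact: le_trans nb abr].
Qed.

(** * Heads and tails in l_p and c_0 *)

Section counting_norm.
Context {R : realType} (p : \bar R) (p1 : (1 <= p)%E).
Local Notation N u := (Lnorm (@counting nat R) p (EFin \o u%R)).

Lemma Lnorm_counting_pinfty_le (u : nat -> R) (M : R) : 0 <= M ->
  (forall n, `|u n| <= M) -> (Lnorm (@counting nat R) +oo (EFin \o u) <= M%:E)%E.
Proof.
move=> M0 uM; rewrite unlock; case: ifPn => [_|_]; last by rewrite lee_fin.
by apply/ess_supP; apply: nearW => n /=; rewrite lee_fin.
Qed.

Lemma Lnorm_counting_le (r M : R) (u : nat -> R) : 0 < r -> 0 <= M ->
  (Lnorm (@counting nat R) r%:E (EFin \o u) <= M%:E)%E =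
  (\sum_(0 <= k <oo) (`|u k| `^ r)%:E <= (M `^ r)%:E)%E.
Proof.
move=> r0 M0; rewrite Lnorm_counting//=.
have s0 : (0 <= \sum_(0 <= k <oo) (`|u k| `^ r)%:E)%E.
  by apply: nneseries_ge0 => k _ _; rewrite lee_fin powR_ge0.
have in0 (x : \bar R) : (0 <= x)%E -> x \in `[0%E, +oo%E].
  by move=> x0; rewrite in_itv/= x0 leey.
have M1 : (M%:E = (M `^ r)%:E `^ r^-1)%E.
  by rewrite poweR_EFin -powRrM mulfV ?gt_eqF// powRr1.
apply/idP/idP => h.
  set S := (\sum_(_ <= _ <oo) _)%E in s0 h *.
  have -> : (S = (S `^ r^-1) `^ r)%E.
    by rewrite -poweRrM mulVf ?gt_eqF// poweRe1.
  rewrite -poweR_EFin; apply: gt0_ler_poweR => //.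
  - exact: ltW.
  - exact/in0/poweR_ge0.
  - exact/in0.
rewrite M1; apply: gt0_ler_poweR => //; [by rewrite invr_ge0 ltW|exact/in0|].
by apply/in0; rewrite lee_fin powR_ge0.
Qed.

Lemma nneseries_single (k : nat) (f : nat -> R) : (forall n, 0 <= f n) ->
  (forall n, n != k -> f n = 0) -> (\sum_(0 <= n <oo) (f n)%:E = (f k)%:E)%E.
Proof.
move=> f0 fk; rewrite (@nneseriesD1 _ _ k)//=; last first.
  by move=> n _; rewrite lee_fin.
by rewrite eseries0 ?adde0// => n _ nk; rewrite fk.
Qed.

Lemma Lnorm_single (k : nat) (u : nat -> R) :
  (N (fun n => if n == k then u n else 0%R) <= `|u k|%:E)%E.
Proof.
case: p p1 => [r r1||//]; last first.
  move=> _; apply: Lnorm_counting_pinfty_le => // n.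
  by case: eqP => [->//|_]; rewrite normr0.
have r0 : 0 < r by rewrite (lt_le_trans ltr01).
rewrite Lnorm_counting_le// (@nneseries_single k)/= ?eqxx//.
  by move=> n /negPf ->; rewrite normr0 powR0 ?gt_eqF.
Qed.

(** The triangle inequality applied to the m coordinates one at a time: on
    finitely many coordinates, coordinatewise smallness is smallness in norm,
    whatever p is. *)
Lemma Lnorm_head (m : nat) (u : nat -> R) :
  (N (fun n => if (n < m)%N then u n else 0%R) <= (\sum_(k < m) `|u k|)%:E)%E.
Proof.
elim: m => [|m ih].
  rewrite big_ord0 (_ : (fun=> _) = (fun=> 0)); last by apply/funext.
  have := @Lnorm_single 0 (fun=> 0); rewrite normr0; apply: le_trans.
  by apply: le_Lnorm_counting => // n; case: ifP.
rewrite big_ord_recr/= EFinD.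
apply: le_trans (leeD ih (Lnorm_single m u)).
apply: le_trans (LnormD_counting p1 _ _).
apply: le_Lnorm_counting => // n /=.
rewrite ltnS leq_eqVlt; case: (ltngtP n m) => //= _; rewrite ?addr0 ?add0r//.
Qed.

(** For p = +oo this is where [ell_mem] means c_0 rather than l_oo. *)
Lemma Lnorm_tail (b : nat -> R) (e : R) : ell_mem p b -> 0 < e ->
  exists m, (N (fun n => if (n < m)%N then 0%R else b n) <= e%:E)%E.
Proof.
case: p p1 => [r r1||//]; last first.
  move=> _ /= + e0; rewrite /ell_mem eqxx => /cvgr0Pnorm_le /(_ e e0) [m _ hm].
  exists m; apply: Lnorm_counting_pinfty_le; first exact: ltW.
  move=> n; case: ltnP => [_|mn]; first by rewrite normr0 ltW.
  exact: hm.
have r0 : 0 < r by rewrite (lt_le_trans ltr01).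
rewrite /ell_mem/= /finite_norm => boo e0.
have Soo : (\sum_(0 <= k <oo) (`|b k| `^ r)%:E < +oo)%E.
  have : (Lnorm (@counting nat R) r%:E (EFin \o b) <=
      (fine (Lnorm (@counting nat R) r%:E (EFin \o b)))%:E)%E.
    by rewrite fineK// ge0_fin_numE// Lnorm_ge0.
  rewrite Lnorm_counting_le// ?fine_ge0 ?Lnorm_ge0// => h.
  exact: le_lt_trans h (ltry _).
have f0 k : true -> (0 <= (`|b k| `^ r)%:E)%E by rewrite lee_fin powR_ge0.
have [m _ hm] : \forall m \near \oo,
    (\sum_(m <= k <oo) (`|b k| `^ r)%:E < (e `^ r)%:E)%E.
  apply: (nneseries_tail_cvg Soo f0 (t := [set x | (x < (e `^ r)%:E)%E])).
  apply: open_nbhs_nbhs; split; first exact: open_ereal_lt_ereal.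
  by rewrite /= lte_fin powR_gt0.
exists m.
rewrite Lnorm_counting_le ?(ltW e0)//.
apply: le_trans (ltW (hm m (leqnn m) : (_ < _)%E)).
rewrite (nneseries_split _ m)//.
rewrite big1_seq ?add0e; last first.
  move=> k /=; rewrite mem_index_iota => /andP[_ km].
  by rewrite add0n in km; rewrite km normr0 powR0// gt_eqF.
rewrite add0n; apply: lee_nneseries => k.
  by rewrite lee_fin powR_ge0.
by move=> _; case: ltnP => // _; rewrite normr0 powR0 ?gt_eqF// lee_fin powR_ge0.
Qed.
End counting_norm.

(** * Compact boxes in l_p and c_0 *)

Section ell_topology.
Context {R : realType} {s : scalars} {p : \bar R} (p1 : (1 <= p)%E).
Local Notation K := (scalar_field R s).
Local Notation ell := (ell s p1).
Local Notation N u := (Lnorm (@counting nat R) p (EFin \o u%R)).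

Lemma ell_norm_leP (x : ell) (r : R) :
  (`|x| <= of_real s r) = (N (fun n => modulus (x n : K)) <= r%:E)%E.
Proof.
by rewrite -[LHS]/(ell_norm x <= of_real s r) ler_of_real -lee_fin ell_normE.
Qed.

Lemma near_ell {T : Type} (F : set_system T) {FF : Filter F} (f : T -> ell) (l : ell) :
  f @ F --> l <->
  (forall r : R, 0 < r -> \near F, `|f F - l| <= of_real s r).
Proof.
split.
  move=> /cvgrPdist_le fl r r0.
  have : 0 < of_real s r by rewrite of_real_gt0.
  by move=> /fl; apply: filterS => x; rewrite distrC.
move=> fl; apply/cvgrPdist_le => e e0.
apply: filterS (fl (modulus e) (modulus_gt0 e0)) => x.
by rewrite of_real_modulusK// distrC.
Qed.

Lemma ell_coord_norm_le (x : ell) n (r : R) :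
  `|x| <= of_real s r -> modulus (x n : K) <= r.
Proof.
by move=> xr; rewrite -(@ler_of_real R s) of_real_modulus (le_trans (le_ell_norm x n)).
Qed.

Lemma near_ell_coord (x : ell) (e : R) : 0 < e ->
  nbhs x [set x' : ell | forall n, modulus (x' n : K) <= modulus (x n : K) + e].
Proof.
move=> e0; have Fx : Filter (nbhs x) by exact: nbhs_filter.
have : nbhs x [set x' : ell | `|x' - x| <= of_real s e].
  by apply: (@near_ell ell (nbhs x) Fx id x).1 => //; exact: cvg_id.
apply: filterS => x' xx' n.
have -> : (x' n : K) = x n + (x' - x) n by rewrite /= addrC subrK.
apply: (le_trans (ler_modulusD _ _)); rewrite lerD2l.
exact: ell_coord_norm_le.
Qed.

(** The coordinates of an ultrafilter F containing the box converge, because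
    they stay in discs. Their limits again satisfy the bounds, so they form an
    element of [ell]. The norm of x - l is at most that of its first m
    coordinates, small along F, plus that of twice the tail of b, small for
    large m. *)
Lemma ell_box_compact (b : nat -> R) : ell_mem p b ->
  compact [set x : ell | forall n, modulus (x n : K) <= b n].
Proof.
move=> bp; rewrite compact_ultra => F UF Fb.
have FF : ProperFilter F by exact: ultra_proper.
have coord n : exists l : K^o, (fun x : ell => x n) @ F --> l.
  have [C Cc bC] := @modulus_disc_sub_compact R s (b n).
  have FC : ((fun x : ell => x n) @ F) C.
    by rewrite /fmap /=; apply: filterS Fb => x xb; apply: bC; exact: xb.
  have [l [_ Fl]] := Cc _ (fmap_proper_filter _ FF) FC.
  exists l => U Ul /=.
  case: (in_ultra_setVsetC ((fun x : ell => x n) @^-1` U) UF) => // FU.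
  by have [z [zU /zU]] := Fl (~` U) U FU Ul.
pose l n := projT1 (cid (coord n)).
have cl n : (fun x : ell => x n) @ F --> l n by exact: (projT2 (cid (coord n))).
have lb n : modulus (l n : K) <= b n.
  apply/ler_addgt0Pr => e e0.
  have H : F [set x : ell | modulus (x n - l n : K) <= e].
    by move/near_modulus : (cl n); apply.
  have [x [xb xe]] := filter_ex (filterI Fb H).
  have -> : (l n : K) = x n - (x n - l n) by rewrite subKr.
  by apply: (le_trans (ler_modulusD _ _)); rewrite modulusN lerD.
have lp : ell_mem p (fun n => modulus (l n : K)).
  apply: le_ell_mem bp => // n; rewrite ger0_norm ?modulus_ge0//.
  exact: le_trans (lb n) (ler_norm _).
pose L : ell := @Ell R s p p1 l (introT (ell_predP p1 l) lp).
exists L; split => //=; apply/(@near_ell ell F FF id L) => r r0.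
have [m hm] := Lnorm_tail p1 (ell_memZ p1 (ler0n R 2) bp) (divr_gt0 r0 (ltr0n R 2)).
(* m.+1 rather than m, so that the bound makes sense for m = 0 *)
have m0 : 0 < m.+1%:R :> R by rewrite ltr0n.
have Hm : F [set x : ell | forall k, (k < m)%N ->
    modulus (x k - l k : K) <= r / 2 / m.+1%:R].
  elim: {1}m => [|j ih]; first by apply: nearW => x k.
  have H : F [set x : ell | modulus (x j - l j : K) <= r / 2 / m.+1%:R].
    by move/near_modulus : (cl j); apply; rewrite !divr_gt0.
  apply: filterS2 ih H => x xj xjj k.
  by rewrite ltnS leq_eqVlt => /predU1P[->//|]; exact: xj.
apply: filterS2 Fb Hm => x xb xm; rewrite ell_norm_leP.
pose u n := modulus (x n - l n : K).
have hu : (N (fun n => if (n < m)%N then u n else 0%R) <= (r / 2)%:E)%E.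
  apply: (le_trans (Lnorm_head p1 m u)); rewrite lee_fin.
  apply: (@le_trans _ _ (\sum_(k < m) (r / 2 / m.+1%:R))).
    by apply: ler_sum => k _; rewrite ger0_norm ?modulus_ge0//; exact: xm.
  rewrite sumr_const card_ord -[leLHS]mulr_natr mulrAC ler_pdivrMr//.
  by rewrite ler_pM2l ?divr_gt0// ler_nat.
rewrite (splitr r) EFinD; apply: le_trans (leeD hu hm).
apply: le_trans (LnormD_counting p1 _ _).
apply: le_Lnorm_counting => // n /=; rewrite -/(u n).
have un : u n <= 2 * b n.
  apply: (le_trans (ler_modulusD _ _)); rewrite modulusN.
  by move: (xb n) (lb n); lra.
have u0 : 0 <= u n by exact: modulus_ge0.
case: ltnP => _; first by rewrite addr0.
by rewrite add0r !ger0_norm// (le_trans u0).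
Qed.

End ell_topology.

(** * Continuous functionals on the weak* and the strong dual *)

Lemma cvg_initial {S : choiceType} {T : topologicalType} (f : S -> T)
    (F : set_system S) (x : S) : Filter F ->
  f @ F --> f x -> F --> (x : initial_topology f).
Proof.
move=> FF fx A [_ [[B Bop <-] Bfx BA]].
have BF : F (f @^-1` B) by apply: fx; exact: open_nbhs_nbhs.
exact: filterS BF.
Qed.

Section uniformly_small.
Context {R : realType} {s : scalars}.
Local Notation K := (scalar_field R s).
Context (E : preTopologicalLmodType K) (fam : set (set E)).

(** A base of neighborhoods of 0 for the topology of uniform convergence on the
    members of [fam], when [fam] is closed under finite unions. The strong and
    the weak* topology are built from other data (a supremum of uniform
    structures, a product); only the convergence of this filter to 0 in each of
    them is needed. *)
Definition uniformly_small : set_system (dual E) :=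
  filter_from [set Be : set E * R | fam Be.1 /\ 0 < Be.2]
    (fun Be => [set f | forall x, Be.1 x -> modulus (clin_fun f x : K) <= Be.2]).

Hypotheses (fam0 : fam set0)
  (famU : forall A B, fam A -> fam B -> fam (A `|` B)).

Lemma uniformly_small_filter : Filter uniformly_small.
Proof.
apply: filter_from_filter; first by exists (set0, 1).
move=> [A a] [B b] [/= fA a0] [/= fB b0]; exists (A `|` B, Num.min a b).
  by split => /=; [exact: famU|rewrite lt_min a0].
move=> f /= h; split => x xA.
  by apply: (le_trans (h x (or_introl xA))); rewrite ge_min lexx.
by apply: (le_trans (h x (or_intror xA))); rewrite ge_min lexx orbT.
Qed.

(** Continuity at 0 provides B in [fam] and e > 0 with |chi f| <= 1 whenever
    |f| <= e on B; scaling gives the constant e^-1. *)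
Lemma continuous_functional_bound (chi : dual E -> K^o) : linear chi ->
  chi @ uniformly_small --> (0 : K^o) ->
  exists2 B, fam B & exists2 C : R, 0 < C & forall (f : dual E) (r : R), 0 <= r ->
    (forall x, B x -> modulus (clin_fun f x : K) <= r) ->
    modulus (chi f : K) <= C * r.
Proof.
move=> lchi cchi.
have : uniformly_small [set f | modulus (chi f - 0 : K) <= 1].
  exact: (@near_modulus _ _ _ _ uniformly_small_filter _ _).1 cchi 1 ltr01.
move=> [[B e] /= [fB e0] Bchi].
exists B => //; exists e^-1.
  by rewrite invr_gt0.
move=> f r r0 fr; rewrite mulrC ler_pdivlMr// mulrC.
(* f is scaled by e / (r + d), as r may vanish *)
apply/ler_addgt0Pr => d d0.
have rd : 0 < r + d by rewrite ltr_wpDl.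
have chiZ (a : K) : chi (a *: f) = a *: chi f.
  have chi0 : chi 0 = 0 by have := lchi (-1) 0 0; rewrite scaler0 addr0 scaleN1r addNr.
  by have := lchi a f 0; rewrite chi0 !addr0.
have := Bchi (of_real s (e / (r + d)) *: f).
rewrite /= subr0 chiZ modulusM modulus_of_real ?divr_ge0 ?(ltW e0) ?(ltW rd)//.
rewrite mulrAC ler_pdivrMr// mul1r; apply => x Bx.
rewrite [X in modulus X](_ : _ = of_real s (e / (r + d)) * clin_fun f x)//.
rewrite modulusM modulus_of_real ?divr_ge0 ?(ltW e0) ?(ltW rd)//.
rewrite mulrAC ler_pdivrMr// ler_pM2l//.
by apply: (le_trans (fr x Bx)); rewrite lerDl ltW.
Qed.

End uniformly_small.

Section dual_topologies.
Context {R : realType} {s : scalars}.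
Local Notation K := (scalar_field R s).
Context (E : tvsType K).

Lemma tvs_bounded0 : tvs_bounded E set0.
Proof. by move=> U _; exists 1; split => [|r _ x []]; first exact: ltr01. Qed.

Lemma tvs_boundedU (A B : set E) :
  tvs_bounded E A -> tvs_bounded E B -> tvs_bounded E (A `|` B).
Proof.
move=> bA bB U U0; have [a [a0 aA]] := bA U U0; have [b [b0 bB']] := bB U U0.
exists (a + b); split; first exact: addr_gt0.
move=> r abr x [/aA|/bB'] H; apply: H; apply: le_lt_trans abr.
  by rewrite lerDl ltW.
by rewrite lerDr ltW.
Qed.

Let finite_setUI (A B : set E) : finite_set A -> finite_set B -> finite_set (A `|` B).
Proof. by rewrite finite_setU. Qed.

Lemma uniformly_small_finite_cvg :
  uniformly_small (@finite_set E) --> (0 : weak_star_dual E).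
Proof.
have FF := @uniformly_small_filter R s E _ (finite_set0 E) finite_setUI.
apply: cvg_initial; apply/pointwise_cvgP => x.
apply/(@near_modulus _ _ _ _ FF) => r r0.
have : uniformly_small (@finite_set E) [set f | modulus (clin_fun f x : K) <= r].
  exists ([set x], r) => /= [|f]; last by apply.
  by split => //; exact: finite_set1.
by apply: filterS => f /=; rewrite subr0.
Qed.

Lemma uniformly_small_bounded_cvg :
  uniformly_small (@tvs_bounded K E) --> (0 : strong_dual E).
Proof.
have FF := @uniformly_small_filter R s E _ tvs_bounded0 tvs_boundedU.
apply: cvg_initial; apply/fam_cvgP => A bA P /uniform_nbhs[V [entV VP]].
have [e e0 eV] : filter_from [set x | 0 < x]
    (fun e : K => [set xy : K^o * K^o | ball xy.1 e xy.2]) V.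
  by rewrite entourage_from_ballE.
have r0 : 0 < modulus e / 2 by rewrite divr_gt0// modulus_gt0.
exists (A, modulus e / 2); first by split.
move=> f /= fA; apply: VP => x Ax /=; apply: eV => /=.
rewrite -ball_normE /= sub0r normrN.
rewrite -of_real_modulus -(of_real_modulusK e0).
rewrite ltr_of_real; apply: le_lt_trans (fA x Ax) _.
by rewrite ltr_pdivrMr// ltr_pMr ?modulus_gt0// ltr1n.
Qed.

Lemma clin0 (D : preTopologicalLmodType K) (chi : dual D) : clin_fun chi 0 = 0.
Proof. exact: (linear0 chi). Qed.

Lemma weak_star_functional_bound (chi : dual (weak_star_dual E)) :
  exists2 B, finite_set B & exists2 C : R, 0 < C &
    forall (f : dual E) (r : R), 0 <= r ->
    (forall x, B x -> modulus (clin_fun f x : K) <= r) ->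
    modulus (clin_fun chi f : K) <= C * r.
Proof.
apply: (@continuous_functional_bound R s E _ (finite_set0 E) finite_setUI).
  by move=> a x y; exact: (clin_linear chi a x y).
have : clin_fun chi @ (0 : weak_star_dual E) --> clin_fun chi 0.
  exact: clin_continuous.
rewrite clin0; apply: cvg_trans; apply: cvg_app.
exact: uniformly_small_finite_cvg.
Qed.

Lemma strong_functional_bound (chi : dual (strong_dual E)) :
  exists2 B, tvs_bounded E B & exists2 C : R, 0 < C &
    forall (f : dual E) (r : R), 0 <= r ->
    (forall x, B x -> modulus (clin_fun f x : K) <= r) ->
    modulus (clin_fun chi f : K) <= C * r.
Proof.
apply: (@continuous_functional_bound R s E _ tvs_bounded0 tvs_boundedU).
  by move=> a x y; exact: (clin_linear chi a x y).
have : clin_fun chi @ (0 : strong_dual E) --> clin_fun chi 0.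
  exact: clin_continuous.
rewrite clin0; apply: cvg_trans; apply: cvg_app.
exact: uniformly_small_bounded_cvg.
Qed.
End dual_topologies.

(** * Summability of the coordinate functionals of an operator *)

Section Sp_summable.
Context {R : realType} {s : scalars} {p : \bar R} (p1 : (1 <= p)%E).
Local Notation K := (scalar_field R s).
Context {E : tvsType K} (T : clin E (ell s p1)).

Lemma ell_mem_sum_modulus (l : seq E) :
  ell_mem p (fun n => \sum_(x <- l) modulus (T x n : K)).
Proof.
elim: l => [|x l ih].
  by under eq_fun do rewrite big_nil; exact: ell_mem0.
under eq_fun do rewrite big_cons.
exact: ell_memD (ell_memP (T x)) ih.
Qed.

(** A weak* continuous functional is controlled by finitely many points x of E,
    and each T x is in l_p. *)
Lemma Sp_weak_star_summable : weakly_summable p (weak_star_dual E) (Sp T).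
Proof.
move=> chi; have [B /finite_seqP[l ->] [C C0 chiC]] := weak_star_functional_bound chi.
apply: (le_ell_mem p1 _ (ell_memZ p1 (ltW C0) (ell_mem_sum_modulus l))) => n.
have s0 : 0 <= \sum_(x <- l) modulus (T x n : K).
  by apply: sumr_ge0 => x _; exact: modulus_ge0.
rewrite !ger0_norm ?modulus_ge0 ?mulr_ge0 ?(ltW C0)//; apply: chiC => // x xl.
rewrite (big_rem x)//= lerDl; apply: sumr_ge0 => y _; exact: modulus_ge0.
Qed.

Lemma bounded_image (B : set E) : tvs_bounded E B ->
  exists2 M : R, 0 < M & forall b, B b -> `|T b| <= of_real s M.
Proof.
move=> bB.
have T0 : T 0 = 0 by exact: (linear0 T).
have U0 : nbhs (0 : E) [set x | `|T x| <= of_real s 1].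
  have : T @ (0 : E) --> T 0 by exact: clin_continuous.
  rewrite T0 => /near_ell /(_ 1 ltr01).
  by apply: filterS => x; rewrite subr0.
have [t [t0 Bt]] := bB _ U0.
have M0 : 0 < modulus (t + 1 : K) by rewrite modulus_gt0// addr_gt0.
exists (modulus (t + 1 : K)) => // b Bb.
have [|u u1 <-] := Bt (t + 1) _ b Bb; first by rewrite ltrDl.
have -> : T ((t + 1) *: u) = (t + 1) *: T u.
  by have := clin_linear T (t + 1) u 0; rewrite T0 !addr0.
rewrite normrZ of_real_modulus ler_piMr//.
by move: u1 => /=; congr (_ <= _); case: (s).
Qed.

End Sp_summable.

Section young.
Context {R : realType}.
Implicit Types x y r e : R.

Lemma powR_predM y r : 1 <= r -> 0 <= y -> y `^ (r - 1) * y = y `^ r.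
Proof.
move=> r1; rewrite le_eqVlt => /predU1P[<-|y0].
  by rewrite mulr0 powR0// gt_eqF// (lt_le_trans ltr01).
rewrite -[X in _ * X](powRr1 (ltW y0)) -powRD ?subrK//.
by rewrite (gt_eqF y0) implybT.
Qed.

(** A form of Young's inequality with a small weight on y and a cruder
    constant, for which comparing x with e * y suffices; it also covers
    r = 1. *)
Lemma weighted_young x y r e : 1 <= r -> 0 <= x -> 0 <= y -> 0 < e ->
  y `^ (r - 1) * x <= e * y `^ r + e^-1 `^ (r - 1) * x `^ r.
Proof.
move=> r1 x0 y0 e0.
have [xy|yx] := leP x (e * y).
  apply: (@le_trans _ _ (e * y `^ r)).
    by rewrite -(powR_predM r1 y0) mulrCA ler_wpM2l ?powR_ge0.
  by rewrite lerDl mulr_ge0 ?powR_ge0.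
apply: (@le_trans _ _ (e^-1 `^ (r - 1) * x `^ r)); last first.
  by rewrite lerDr mulr_ge0 ?powR_ge0// ltW.
rewrite -(powR_predM r1 x0) mulrA -powRM ?invr_ge0 ?(ltW e0)//.
rewrite ler_wpM2r// ge0_ler_powR// ?nnegrE ?subr_ge0 ?mulr_ge0 ?invr_ge0 ?(ltW e0)//.
by rewrite mulrC ler_pdivlMr// mulrC ltW.
Qed.
End young.

Section Sp_strong.
Context {R : realType} {s : scalars} {r : R} (p1 : (1 <= r%:E)%E).
Local Notation K := (scalar_field R s).
Context {E : tvsType K} (T : clin E (ell s p1)).

Lemma clin_sum (D : preTopologicalLmodType K) (chi : dual D) m (c : nat -> K)
    (f : nat -> D) :
  clin_fun chi (\sum_(k < m) c k *: f k) = \sum_(k < m) c k * clin_fun chi (f k).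
Proof.
elim: m => [|m ih]; first by rewrite !big_ord0 clin0.
rewrite !big_ord_recr/= -ih addrC.
by rewrite (clin_linear chi) addrC.
Qed.

Lemma dual_sum_apply m (c : nat -> K) (f : nat -> dual E) (x : E) :
  clin_fun (\sum_(k < m) c k *: f k) x = \sum_(k < m) c k * clin_fun (f k) x.
Proof.
elim: m => [|m ih]; first by rewrite !big_ord0.
by rewrite !big_ord_recr/= -ih.
Qed.

Lemma ell_partial_sum_le (x : ell s p1) (M : R) m : 0 <= M ->
  `|x| <= of_real s M -> \sum_(k < m) modulus (x k : K) `^ r <= M `^ r.
Proof.
have r0 : 0 < r by rewrite (lt_le_trans ltr01).
move=> M0; rewrite ell_norm_leP Lnorm_counting_le// -lee_fin; apply: le_trans.
rewrite -sumEFin -(big_mkord xpredT (fun k => (modulus (x k : K) `^ r)%:E)).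
under eq_eseriesr => k _ do rewrite ger0_norm ?modulus_ge0//.
by apply: nneseries_lim_ge => k _ _; rewrite lee_fin powR_ge0.
Qed.

(** With S the partial sum of |chi (Sp T k)|^r and f the combination of the
    Sp T k for which chi f = S, [weighted_young] bounds f on B by e S + D, hence
    S <= C (e S + D). Since e = 1 / (2 C), the term in S is absorbed and
    S <= 2 C D, where D does not depend on the number of terms. *)
Lemma Sp_strong_summable : weakly_summable r%:E (strong_dual E) (Sp T).
Proof.
have r1 : 1 <= r by [].
have r0 : 0 < r by rewrite (lt_le_trans ltr01).
move=> chi; have [B bB [C C0 chiC]] := strong_functional_bound chi.
have [M M0 BM] := bounded_image T bB.
pose y k : K := clin_fun chi (Sp T k).
pose S m := \sum_(k < m) modulus (y k) `^ r.
pose e := (2 * C)^-1.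
have e0 : 0 < e by rewrite invr_gt0 mulr_gt0.
pose D := e^-1 `^ (r - 1) * M `^ r.
have D0 : 0 <= D by rewrite mulr_ge0 ?powR_ge0.
have S0 m : 0 <= S m by apply: sumr_ge0 => k _; exact: powR_ge0.
have SD m : S m <= 2 * C * D.
  have /choice[u hu] : forall k, exists u : K,
    modulus u = 1 /\ u * y k = of_real s (modulus (y k)) by move=> k; exact: ex_phase.
  (* the extremal coefficients of Hoelder's inequality *)
  pose c k : K := u k * of_real s (modulus (y k) `^ (r - 1)).
  have mc k : modulus (c k) = modulus (y k) `^ (r - 1).
    by rewrite /c modulusM (hu k).1 mul1r modulus_of_real// powR_ge0.
  pose f : dual E := \sum_(k < m) c k *: (Sp T k : dual E).
  have chif : clin_fun chi f = of_real s (S m).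
    rewrite /f (@clin_sum (strong_dual E)).
    rewrite /S (@of_real_sum R s m (fun k => modulus (y k) `^ r)).
    apply: eq_bigr => k _; rewrite -/(y k) /c mulrAC (hu k).2 -of_realM mulrC.
    by rewrite powR_predM// modulus_ge0.
  have : modulus (clin_fun chi f : K) <= C * (e * S m + D).
    apply: chiC; first by rewrite addr_ge0// mulr_ge0// ltW.
    move=> b /BM Tb; rewrite dual_sum_apply.
    apply: (le_trans (ler_modulus_sum m (fun k => c k * clin_fun (Sp T k) b))).
    apply: (@le_trans _ _ (\sum_(k < m) (e * modulus (y k) `^ r +
        e^-1 `^ (r - 1) * modulus (T b k : K) `^ r))).
      apply: ler_sum => k _; rewrite modulusM mc.
      exact: weighted_young (modulus_ge0 _) (modulus_ge0 _) e0.
    rewrite big_split/= -!mulr_sumr lerD2l ler_wpM2l ?powR_ge0//.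
    exact: ell_partial_sum_le (ltW M0) Tb.
  rewrite chif modulus_of_real// mulrDr mulrA.
  have -> : C * e = 2^-1 by rewrite /e invfM mulrCA divff ?mulr1// gt_eqF.
  by lra.
rewrite /ell_mem/= /finite_norm.
have CD0 : 0 <= 2 * C * D by exact: le_trans (S0 0%N) (SD 0%N).
suff : (Lnorm (@counting nat R) r%:E
    (EFin \o (fun n => modulus (clin_fun chi (Sp T n) : K))) <=
    ((2 * C * D) `^ r^-1)%:E)%E by move/le_lt_trans; apply; exact: ltry.
rewrite Lnorm_counting_le ?powR_ge0// -powRrM mulVf ?gt_eqF// powRr1//.
apply: lime_le; first by apply: is_cvg_nneseries => k _ _; rewrite lee_fin powR_ge0.
apply: nearW => m; rewrite big_mkord sumEFin lee_fin.
apply: le_trans (SD m); apply: ler_sum => k _.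
by rewrite ger0_norm ?modulus_ge0.
Qed.
End Sp_strong.

(** * Coarse p-limited sets *)

Section coarse.
Context {R : realType} {s : scalars}.
Local Notation K := (scalar_field R s).
Context {E : tvsType K}.

(** The suprema are the sides of a compact box that contains the image of A. *)
Lemma sup_ell_mem_precompact (p : \bar R) (p1 : (1 <= p)%E) (A : set E)
  (T : clin E (ell s p1)) : sup_ell_mem p A (Sp T) -> precompact [set T a | a in A].
Proof.
move=> [ub pA]; apply: precompact_subset; last first.
  apply: (compact_precompact _ (ell_box_compact pA)); exact: norm_hausdorff.
move=> _ [a Aa <-] n; apply: ub_le_sup; first exact: ub.
by exists a.
Qed.

(** Compactness turns a pointwise property into a uniform one: near each point x
    of the closure of T(A), the tails are within e / 2 of those of x, which
    belongs to c_0; finitely many such neighborhoods suffice. The bound on each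
    coordinate comes from the same covering argument. *)
Lemma precompact_sup_ell_mem (p1 : (1 <= +oo :> \bar R)%E) (A : set E)
  (T : clin E (ell s p1)) : A !=set0 -> precompact [set T a | a in A] ->
  sup_ell_mem +oo A (Sp T).
Proof.
move=> [a0 Aa0]; rewrite precompactE => /compact_near_coveringP cA.
pose cl := closure [set T a | a in A].
have bound n : exists M : R, forall x : ell s p1, cl x -> modulus (x n : K) <= M.
  have : \forall k \near \oo, cl `<=` [set x : ell s p1 | modulus (x n : K) <= k%:R].
    apply: cA => x clx.
    have kx := nbhs_infty_ger (modulus (x n : K) + 1).
    exists ([set x' : ell s p1 | forall n, modulus (x' n : K) <= modulus (x n : K) + 1],
        [set k | modulus (x n : K) + 1 <= k%:R]) => /=.
      by split => //; exact: near_ell_coord.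
    by move=> [x' k] /= [hx' hk]; exact: le_trans (hx' n) hk.
  by move=> /filter_ex[k hk]; exists k%:R.
have tail (e : R) : 0 < e -> \forall n \near \oo,
    forall x : ell s p1, cl x -> modulus (x n : K) <= e.
  move=> e0; apply: cA => x clx.
  have xoo := ell_memP x; rewrite /ell_mem eqxx in xoo.
  have e2 : 0 < e / 2 by rewrite divr_gt0.
  move/cvgr0Pnorm_le : xoo => /(_ _ e2) nx.
  exists ([set x' : ell s p1 | forall n, modulus (x' n : K) <= modulus (x n : K) + e / 2],
      [set n | `|modulus (x n : K)| <= e / 2]) => /=.
    by split => //; exact: near_ell_coord.
  move=> [x' n] /= [hx' hn]; apply: (le_trans (hx' n)).
  by rewrite ger0_norm ?modulus_ge0// in hn; rewrite [leRHS]splitr lerD2r.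
have Acl a : A a -> cl (T a) by move=> Aa; apply: subset_closure; exists a.
pose X n := [set modulus (clin_fun (Sp T n) a : K) | a in A].
have ubX n : has_ubound (X n).
  have [M hM] := bound n; exists M => _ [a Aa <-]; exact/hM/Acl.
split => //; rewrite /ell_mem eqxx; apply/cvgr0Pnorm_le => e e0.
apply: filterS (tail e e0) => n hn.
rewrite -/(X n) ger0_norm; last first.
  apply: le_trans (modulus_ge0 (clin_fun (Sp T n) a0 : K)) _.
  by apply: ub_le_sup => //; exists a0.
apply: ge_sup; first by exists (modulus (clin_fun (Sp T n) a0 : K)), a0.
by move=> _ [a Aa <-]; exact/hn/Acl.
Qed.
End coarse.

Theorem proposition4p2 (R : realType) (s : scalars)
    (E : tvsType (scalar_field R s)) (hausE : hausdorff_space E) :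
  (forall (p : \bar R) (p1 : (1 <= p)%E),
    [set Sp T | T in [set: clin E (ell s p1)]] `<=`
      weakly_summable p (strong_dual E) ->
    Vstar E p p `<=` coarse_limited E p1) /\
  (forall (p : \bar R) (p1 : (1 <= p)%E),
    (1 < p)%E -> (p < +oo)%E ->
    Vstar E p p `<=` coarse_limited E p1) /\
  (forall (p1 : (1 <= +oo :> \bar R)%E),
    [set Sp T | T in [set: clin E (ell s p1)]] =
      weakly_summable +oo (strong_dual E) ->
    Vstar E +oo +oo = coarse_limited E p1) /\
  (forall (p : \bar R) (p1 : (1 <= p)%E),
    limited E p `<=` coarse_limited E p1 /\
    (forall A : set E, A !=set0 -> finite_set A -> coarse_limited E p1 A)).
Proof.
have i (p : \bar R) (p1 : (1 <= p)%E) :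
    [set Sp T | T in [set: clin E (ell s p1)]] `<=`
      weakly_summable p (strong_dual E) ->
    Vstar E p p `<=` coarse_limited E p1.
  move=> SpE A [A0 VA]; split => // T; apply: sup_ell_mem_precompact.
  by apply: VA; apply: SpE; exists T.
split => //; split; [|split].
- move=> p p1 _ poo; apply: i => _ [T _ <-].
  case: p p1 poo T => [r||] // p1 _ T; exact: Sp_strong_summable.
- move=> p1 SpE; apply/seteqP; split; first by apply: i; rewrite SpE.
  move=> A [A0 cA]; split => // chi; rewrite -SpE => -[T _ <-].
  exact: precompact_sup_ell_mem.
- move=> p p1; split=> [A [A0 lA]|A A0 fA]; split => // T.
    by apply: sup_ell_mem_precompact; apply: lA; exact: Sp_weak_star_summable.
  apply: compact_precompact; first exact: norm_hausdorff.
  by apply: finite_compact; exact: finite_image.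
Qed.
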